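(* Let $n,k\ge1$, $\sigma>0$, let $X\in\mathbb{R}^{n\times k}$ be fixed, and let $Y$ be a random $n\times k$ matrix with $Y_{i,j}\sim\mathcal{N}(X_{i,j},\sigma^2)$, the entries being independent along each column. For $\Theta\in\mathbb{R}^{n\times n}$ and $\beta\in\mathbb{R}^n$ let $\mathcal{R}_{\Theta,\beta}(X)=\mathbb{E}\|\Theta Y+\beta\mathbf{1}_k^\top-X\|_F^2$. Then $$\mathop{\arg\min}_{\Theta\in\mathbb{R}^{n\times n},\ \beta\in\mathbb{R}^n}\mathcal{R}_{\Theta,\beta}(X)=(\hat\Theta,\hat\beta),\qquad \hat\Theta=C_X(C_X+\sigma^2I_n)^{-1},\quad \hat\beta=(I_n-\hat\Theta)\mu_X .$$
   Context: $\|\cdot\|_F$ is the Frobenius norm, $\mathbf{1}_k$ the all-ones vector in $\mathbb{R}^k$, $I_n$ the identity. ''Independent along each column'' means that for each $j$ the variables $Y_{1,j},\dots,Y_{n,j}$ are independent. For $Z\in\mathbb{R}^{n\times k}$, $\mu_Z=\frac1k Z\mathbf{1}_k\in\mathbb{R}^n$ and $C_Z=\frac1k(Z-\mu_Z\mathbf{1}_k^\top)(Z-\mu_Z\mathbf{1}_k^\top)^\top\in\mathbb{R}^{n\times n}$. *)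

(* Defs.v *)
From HB Require Import structures.
From mathcomp Require Export all_boot all_order all_algebra.
From mathcomp Require Export all_classical all_reals all_analysis.
Set Implicit Arguments.
Unset Strict Implicit.
Unset Printing Implicit Defensive.
Import Order.TTheory GRing.Theory Num.Theory.
Import numFieldNormedType.Exports.
Local Open Scope classical_set_scope.
Local Open Scope ring_scope.

Definition argmin (R : realType) (S : Type) (f : S -> \bar R) : set S :=
  [set x | forall y, (f x <= f y)%E].

(* The values of a measure on nonmeasurable sets carry no meaning, so laws are
   compared on Borel sets only. The second parameter of [normal_prob] is the
   standard deviation: this is N(m, s^2). *)
Definition has_normal_law d (T : measurableType d) (R : realType)
    (P : probability T R) (Z : {RV P >-> R}) (m s : R) : Prop :=
  forall A, measurable A -> distribution P Z A = normal_prob m s A.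

Definition mutually_independent d (T : measurableType d) (R : realType)
    (P : probability T R) (I : finType) (Z : I -> {RV P >-> R}) : Prop :=
  forall (J : {set I}) (B : I -> set R),
    (forall i, i \in J -> measurable (B i)) ->
    P (\bigcap_(i in [set` J]) (Z i @^-1` B i)) =
      (\prod_(i in J) P (Z i @^-1` B i))%E.

(* The norm `|A| on matrices provided by the library is the sup norm. *)
Definition frobenius_norm (R : realType) (m n : nat) (A : 'M[R]_(m, n)) : R :=
  Num.sqrt (\sum_(i < m) \sum_(j < n) A i j ^+ 2).

Definition ones (R : realType) (k : nat) : 'cV[R]_k := const_mx 1.

Definition col_mean (R : realType) (n k : nat) (Z : 'M[R]_(n, k)) : 'cV[R]_n :=
  k%:R^-1 *: (Z *m ones R k).

Definition col_cov (R : realType) (n k : nat) (Z : 'M[R]_(n, k)) : 'M[R]_n :=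
  k%:R^-1 *: ((Z - col_mean Z *m (ones R k)^T) *m
              (Z - col_mean Z *m (ones R k)^T)^T).

Definition rv_matrix d (T : measurableType d) (R : realType)
    (P : probability T R) (n k : nat) (Y : 'I_n -> 'I_k -> {RV P >-> R})
    (w : T) : 'M[R]_(n, k) :=
  \matrix_(i, j) Y i j w.

Definition risk d (T : measurableType d) (R : realType)
    (P : probability T R) (n k : nat) (X : 'M[R]_(n, k))
    (Y : 'I_n -> 'I_k -> {RV P >-> R})
    (Theta : 'M[R]_n) (beta : 'cV[R]_n) : \bar R :=
  ('E_P[fun w => (frobenius_norm
      (Theta *m rv_matrix Y w + beta *m (ones R k)^T - X) ^+ 2)%R])%E.

Definition Theta_hat (R : realType) (n k : nat) (X : 'M[R]_(n, k)) (sigma : R)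
    : 'M[R]_n :=
  col_cov X *m invmx (col_cov X + (sigma ^+ 2)%:M).

Definition beta_hat (R : realType) (n k : nat) (X : 'M[R]_(n, k)) (sigma : R)
    : 'cV[R]_n :=
  (1%:M - Theta_hat X sigma) *m col_mean X.

(* Main.v *)
(** Centering the noise [W = Y - X], the columns of [W] have mean [0] and
    covariance [sigma^2 I], so that the risk is the deterministic quadratic
    [|Theta X + beta 1^T - X|^2 + k sigma^2 |Theta|^2].  With
    [Xc = X - mu 1^T], the residual at the candidate minimizer is
    [(Theta_hat - I) Xc], where [Xc 1 = 0] and [Xc X^T = k C].  Hence moving by
    [(D, b)] adds exactly [|D X + b 1^T|^2 + k sigma^2 |D|^2], which is
    positive unless [D = 0] and [b = 0]. *)
Require Import Defs.
From mathcomp Require Import ring lra measurable_realfun.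
Set Implicit Arguments.
Unset Strict Implicit.
Unset Printing Implicit Defensive.
Import Order.TTheory GRing.Theory Num.Theory.
Import numFieldNormedType.Exports.
Local Open Scope classical_set_scope.
Local Open Scope ring_scope.

(** * Gaussian integrals and changes of variable on the real line *)

Section normal_moments.
Variable R : realType.
Notation mu := (@lebesgue_measure R).

Lemma is_derive_normal_pdf (s x : R) : s != 0 ->
  is_derive x 1 (normal_pdf 0 s) (- (x / s ^+ 2 * normal_pdf 0 s x)).
Proof.
move=> s0; rewrite (normal_pdfE _ s0) /normal_fun.
set c := - (s ^+ 2 *+ 2)^-1.
have -> : (fun t : R => normal_peak s * expR (- (t - 0) ^+ 2 / (s ^+ 2 *+ 2))) =
  normal_peak s \*: (expR \o (c \*: (id : R -> R) ^+ 2)).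
  apply/funext => t; rewrite subr0 !fctE/= /GRing.scale/=; congr (_ * expR _).
  by rewrite /c; field.
have dsq := is_deriveZ c (is_deriveX 2 (is_derive_id x 1)).
have dexp := is_derive1_comp (is_derive_expR _) dsq.
apply: is_derive_eq (is_deriveZ (normal_peak s) dexp) _.
rewrite /GRing.scale/= /GRing.scale/= subr0.
have -> : - x ^+ 2 / (s ^+ 2 *+ 2) = c * x ^+ 2 by rewrite /c; field.
by rewrite /c; field.
Qed.

(** With [y = x^2 / (2 s^2)] one has [x^4 = 4 s^4 y^2] and [y^2 / 2 <= exp y], which bounds the
    product by [8 s^4] times the peak; 16 leaves slack. *)
Lemma normal_pdf_decay (s x : R) : s != 0 ->
  x ^+ 4 * normal_pdf 0 s x <= 16 * s ^+ 4 * normal_peak s.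
Proof.
move=> s0; rewrite (normal_pdfE _ s0) /normal_fun subr0.
set y := x ^+ 2 / (s ^+ 2 *+ 2).
have y0 : 0 <= y by rewrite mulr_ge0 ?sqr_ge0// invr_ge0 mulrn_wge0 ?sqr_ge0.
have -> : - x ^+ 2 / (s ^+ 2 *+ 2) = - y by rewrite mulNr.
have -> : x ^+ 4 = 4 * s ^+ 4 * y ^+ 2 by rewrite /y; field.
have h : y ^+ 2 / 2 <= expR y.
  by rewrite (le_trans _ (expR_ge1Dxn 1 y0))// lerDr.
have s4 : 0 <= s ^+ 4 by rewrite exprn_even_ge0.
have := ler_wpM2r (expR_ge0 (- y)) h; rewrite -expRD subrr expR0 => h1.
have := ler_wpM2l (mulr_ge0 s4 (normal_peak_ge0 s)) h1.
have := mulr_ge0 s4 (normal_peak_ge0 s).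
set e := expR _; set q := normal_peak s; set t := s ^+ 4.
nra.
Qed.


Lemma continuous_quadratic_normal_pdf (a b c s : R) : s != 0 ->
  continuous (fun x => (a + b * x + c * x ^+ 2) * normal_pdf 0 s x).
Proof.
move=> s0 x; apply: cvgM; last exact: continuous_normal_pdf.
by do ![exact: cvg_cst | exact: cvg_id | apply: cvgM | apply: cvgD].
Qed.

(** Squeezed between [- K / x] and [K / x]: for [x >= 1] the quadratic is at most a multiple of
    [x^2], and [x^3 <= x^4] lets [normal_pdf_decay] apply. *)
Lemma cvg_quadratic_normal_pdf (a b c s : R) : s != 0 ->
  (a + b * x + c * x ^+ 2) * normal_pdf 0 s x @[x --> +oo] --> 0.
Proof.
move=> s0; pose K := (`|a| + `|b| + `|c|) * (16 * s ^+ 4 * normal_peak s).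
have cK : K * x^-1 @[x --> +oo] --> 0.
  by rewrite -(mulr0 K); apply: cvgMr; apply/gtr0_cvgV0 => //; exact: nbhs_pinfty_gt.
apply: (@squeeze_cvgr _ _ _ _ (fun x => - (K * x^-1)) (fun x => K * x^-1)) => //; last first.
  by rewrite -oppr0; exact: cvgN.
near=> x.
have x1 : 1 <= x by near: x; exact: nbhs_pinfty_ge.
have x0 : 0 < x by rewrite (lt_le_trans _ x1).
rewrite -ler_norml normrM (ger0_norm (normal_pdf_ge0 _ _ _)).
rewrite ler_pdivlMr//.
have := normal_pdf_decay x s0; have := normal_pdf_ge0 0 s x.
rewrite /K; set p := normal_pdf _ _ _; set M := _ * normal_peak s => p0 pM.
have h : `|a + b * x + c * x ^+ 2| <= (`|a| + `|b| + `|c|) * x ^+ 2.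
  rewrite (le_trans (ler_normD _ _))// (le_trans (lerD (ler_normD _ _) (lexx _)))//.
  rewrite (normrM b) (normrM c) (ger0_norm (ltW x0)) (ger0_norm (sqr_ge0 x)) !mulrDl !lerD//.
    by rewrite ler_peMr// exprn_ege1.
  by rewrite ler_wpM2l// expr2 ler_peMr// ltW.
have S0 : 0 <= `|a| + `|b| + `|c| by rewrite !addr_ge0.
apply: le_trans (_ : (`|a| + `|b| + `|c|) * (x ^+ 4 * p) <= _); last exact: ler_wpM2l.
rewrite -mulrA (le_trans (ler_wpM2r _ h)) ?mulr_ge0 ?(ltW x0)//.
rewrite -mulrA ler_wpM2l// [p * x]mulrC mulrA ler_wpM2r//.
by rewrite -exprSr ler_weXn2l.
Unshelve. all: by end_near. Qed.

Lemma is_derive_quadratic_normal_pdf (a b c s x : R) : s != 0 ->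
  is_derive x 1 (fun x => (a + b * x + c * x ^+ 2) * normal_pdf 0 s x)
  ((b + 2 * c * x - x / s ^+ 2 * (a + b * x + c * x ^+ 2)) * normal_pdf 0 s x).
Proof.
move=> s0.
have dq : is_derive x 1 (fun x => a + b * x + c * x ^+ 2) (b + 2 * c * x).
  have -> : (fun x => a + b * x + c * x ^+ 2) =
      (cst a + (b \*: (id : R -> R))) + (c \*: (id : R -> R) ^+ 2) by [].
  apply: is_derive_eq; rewrite /GRing.scale/=; ring.
apply: is_derive_eq (is_deriveM dq (is_derive_normal_pdf x s0)) _.
by rewrite /GRing.scale/=; field.
Qed.

(** The integrand is the derivative of the quadratic times the density, which vanishes at infinity
    and leaves only its value at 0. Nonnegativity of [f] lets the fundamental theorem apply on the
    half-line with no prior integrability. *)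
Lemma integral0y_quadratic_normal_pdf (a b c s : R) : s != 0 ->
  let f x := b + 2 * c * x - x / s ^+ 2 * (a + b * x + c * x ^+ 2) in
  (forall x, 0 <= x -> 0 <= f x) ->
  (\int[mu]_(x in `[0%R, +oo[) (f x * normal_pdf 0 s x)%:E
   = (- (a * normal_pdf 0 s 0))%:E)%E.
Proof.
move=> s0 f f0.
have dF x := is_derive_quadratic_normal_pdf a b c x s0.
have cF := @continuous_quadratic_normal_pdf a b c s s0.
rewrite (ge0_continuous_FTC2y (F := fun x => (a + b * x + c * x ^+ 2) * normal_pdf 0 s x) (l := 0)).
- by rewrite -EFinB sub0r !mulr0 expr0n/= mulr0 !addr0.
- by move=> x x0; rewrite mulr_ge0 ?f0 ?normal_pdf_ge0.
- apply: continuous_subspaceT => x; apply: cvgM; last exact: continuous_normal_pdf.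
  by do ![exact: cvg_cst | exact: cvg_id | apply: cvgM | apply: cvgN | apply: cvgD].
- exact: cvg_quadratic_normal_pdf.
- by move=> x _; exact: ex_derive.
- by apply: cvg_at_right_filter; exact: cF.
- by move=> x _; rewrite derive1E; exact: derive_val.
Qed.


(* [(s^2 - x^2) * pdf] is the derivative of [s^2 * x * pdf] but changes sign.
   Adding [x^3 / s * pdf] makes it nonnegative, and both terms then have an
   antiderivative of the form quadratic times [pdf], with the same integral. *)
Lemma integral0y_sqr_normal_pdf (s : R) : 0 < s ->
  (\int[mu]_(x in `[0%R, +oo[) (x ^+ 2 * normal_pdf 0 s x)%:E =
   \int[mu]_(x in `[0%R, +oo[) (s ^+ 2 * normal_pdf 0 s x)%:E)%E.
Proof.
move=> s0; have sN0 : s != 0 by rewrite gt_eqF.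
pose h1 (x : R) := (s ^+ 2 - x ^+ 2 + x ^+ 3 / s) * normal_pdf 0 s x.
pose h2 (x : R) := x ^+ 3 / s * normal_pdf 0 s x.
pose c0 := 2 * s ^+ 3 * normal_pdf 0 s 0.
have h1_ge0 (x : R) : 0 <= x -> 0 <= s ^+ 2 - x ^+ 2 + x ^+ 3 / s.
  move=> x0.
  have -> : s ^+ 2 - x ^+ 2 + x ^+ 3 / s = s ^+ 2 * (1 - (x / s) ^+ 2 + (x / s) ^+ 3).
    by field.
  rewrite mulr_ge0 ?sqr_ge0//.
  have : 0 <= x / s by rewrite divr_ge0// ltW.
  set u := x / s => u0.
  (* A sum of terms that are visibly nonnegative for [u >= 0]. *)
  have -> : 1 - u ^+ 2 + u ^+ 3 = u * (u - 1) ^+ 2 + (u - 1 / 2) ^+ 2 + 3 / 4 by field.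
  have := mulr_ge0 u0 (sqr_ge0 (u - 1)); have := sqr_ge0 (u - 1 / 2); lra.
(* Matching the coefficients of [x^3 / s] forces [c = - s] and [a = - 2 s^3]. Taking [b = s^2]
   instead of 0 adds [s^2 - x^2] to the derivative factor without changing the value at 0, so [I1]
   and [I2] share [c0]. *)
have I1 : (\int[mu]_(x in `[0%R, +oo[) (h1 x)%:E = c0%:E)%E.
  have -> : c0 = - ((- 2 * s ^+ 3) * normal_pdf 0 s 0) by rewrite /c0; ring.
  have e x : s ^+ 2 + 2 * - s * x - x / s ^+ 2 * (- 2 * s ^+ 3 + s ^+ 2 * x + - s * x ^+ 2)
      = s ^+ 2 - x ^+ 2 + x ^+ 3 / s by field.
  rewrite -(@integral0y_quadratic_normal_pdf _ (s ^+ 2) (- s) s)//.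
    by apply: eq_integral => x _; rewrite /h1 -e.
  by move=> x x0; rewrite e h1_ge0.
have I2 : (\int[mu]_(x in `[0%R, +oo[) (h2 x)%:E = c0%:E)%E.
  have -> : c0 = - ((- 2 * s ^+ 3) * normal_pdf 0 s 0) by rewrite /c0; ring.
  have e x : 0 + 2 * - s * x - x / s ^+ 2 * (- 2 * s ^+ 3 + 0 * x + - s * x ^+ 2) = x ^+ 3 / s.
    by field.
  rewrite -(@integral0y_quadratic_normal_pdf _ 0 (- s) s)//.
    by apply: eq_integral => x _; congr (_%:E); rewrite /h2 -e.
  by move=> x x0; rewrite e divr_ge0 ?exprn_ge0// ltW.
have cp : continuous (normal_pdf 0 s) by exact: continuous_normal_pdf.
have mE (f : R -> R) : continuous f ->
    measurable_fun (`[0, +oo[%classic : set R) (EFin \o f).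
  by move=> cf; apply/measurable_EFinP; apply: measurable_funTS; exact: continuous_measurable_fun.
have cont (f : R -> R) : continuous f -> continuous (fun x : R => f x * normal_pdf 0 s x).
  by move=> cf x; apply: cvgM; [exact: cf|exact: cp].
have ch1 : continuous h1.
  apply: cont => x.
  by do ![exact: cvg_cst | exact: cvg_id | apply: cvgM | apply: cvgN | apply: cvgD].
have ch2 : continuous h2.
  apply: cont => x.
  by do ![exact: cvg_cst | exact: cvg_id | apply: cvgM].
have cx2 : continuous (fun x : R => x ^+ 2 * normal_pdf 0 s x).
  by apply: cont => x; exact: exprn_continuous.
have cs2 : continuous (fun x : R => s ^+ 2 * normal_pdf 0 s x).
  by apply: cont => x; exact: cvg_cst.
have I12 : ((\int[mu]_(x in `[0%R, +oo[) (h1 x)%:E) +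
    \int[mu]_(x in `[0%R, +oo[) (x ^+ 2 * normal_pdf 0 s x)%:E =
    \int[mu]_(x in `[0%R, +oo[) (h2 x)%:E +
    \int[mu]_(x in `[0%R, +oo[) (s ^+ 2 * normal_pdf 0 s x)%:E)%E.
  have D0 (x : R) : (`[0, +oo[%classic : set R) x -> 0 <= x by rewrite /= in_itv/= andbT.
  rewrite -!ge0_integralD//; try exact: mE.
  - apply: eq_integral => x _; rewrite -!EFinD; congr (_%:E).
    by rewrite /h1 /h2; ring.
  - by move=> x /D0 x0; rewrite lee_fin mulr_ge0 ?normal_pdf_ge0// divr_ge0 ?exprn_ge0// ltW.
  - by move=> x _; rewrite lee_fin mulr_ge0 ?normal_pdf_ge0 ?sqr_ge0.
  - by move=> x /D0 x0; rewrite lee_fin mulr_ge0 ?normal_pdf_ge0 ?h1_ge0.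
  - by move=> x _; rewrite lee_fin mulr_ge0 ?normal_pdf_ge0 ?sqr_ge0.
(* The common value [c0] is finite, hence can be cancelled in the extended reals. *)
by move: I12; rewrite I1 I2 !(addeC c0%:E) => /(congr1 (fun z => z - c0%:E)%E); rewrite !addeK.
Qed.

(** Write [s^2] as the integral of [s^2 * pdf]; both integrands are even, so each integral is twice
    its half-line value. *)
Lemma integral_sqr_normal_pdf (s : R) : 0 < s ->
  (\int[mu]_x (x ^+ 2 * normal_pdf 0 s x)%:E = (s ^+ 2)%:E)%E.
Proof.
move=> s0; have sN0 : s != 0 by rewrite gt_eqF.
have cp : continuous (normal_pdf 0 s) by exact: continuous_normal_pdf.
have pN x : normal_pdf 0 s x = normal_pdf 0 s (- x).
  by rewrite !normal_pdfE// /normal_fun !subr0 sqrrN.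
have s1 : (\int[mu]_x (s ^+ 2 * normal_pdf 0 s x)%:E = (s ^+ 2)%:E)%E.
  under eq_integral do rewrite EFinM.
  by rewrite integralZl ?integral_normal_pdf ?mule1//; exact: integrable_normal_pdf.
rewrite -[RHS]s1 !ge0_symfun_integralT.
- congr (_ * _)%E; rewrite -set_itvcy; exact: integral0y_sqr_normal_pdf.
- by move=> x; rewrite mulr_ge0 ?normal_pdf_ge0 ?sqr_ge0.
- by move=> x; apply: cvgM; [exact: cvg_cst|exact: cp].
- by move=> x /=; rewrite -pN.
- by move=> x; rewrite mulr_ge0 ?normal_pdf_ge0 ?sqr_ge0.
- by move=> x; apply: cvgM; [exact: exprn_continuous|exact: cp].
- by move=> x /=; rewrite -pN sqrrN.
Qed.

(** The Radon-Nikodym derivative of [normal_prob] and the explicit density have the same integral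
    over every measurable set, hence agree almost everywhere. *)
Lemma ge0_integral_normal_prob (m s : R) (f : R -> \bar R) :
  measurable_fun [set: R] f -> (forall x, 0 <= f x)%E ->
  (\int[normal_prob m s]_x f x = \int[mu]_x (f x * (normal_pdf m s x)%:E))%E.
Proof.
move=> mf f0; pose nu : {finite_measure set _ -> \bar R} := normal_prob m s.
have nmu : nu `<< mu by exact: normal_prob_dominates.
have mp : measurable_fun [set: R] (EFin \o normal_pdf m s).
  by apply/measurable_EFinP; exact: measurable_normal_pdf.
have iRN := Radon_Nikodym_SigmaFinite.f_integrable nmu.
rewrite -(Radon_Nikodym_SigmaFinite.change_of_variables nmu)//.
apply: ae_eq_integral => //.
- by apply: emeasurable_funM => //; exact: measurable_int iRN.
- exact: emeasurable_funM.
apply: ae_eqe_mul2l; apply: integral_ae_eq => //.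
by move=> E _ mE; rewrite -Radon_Nikodym_SigmaFinite.f_integral.
Qed.

Lemma ge0_integral_shift (m : R) (f : R -> R) :
  continuous f -> (forall x, 0 <= f x) ->
  (\int[mu]_x (f x)%:E = \int[mu]_x (f (x + m))%:E)%E.
Proof.
move=> cf f0.
have d1 : (fun x : R => x + m)^`()%classic = cst 1.
  by apply/funext => x; rewrite derive1E; apply: derive_val; apply: is_derive_eq (addr0 _).
rewrite (increasing_ge0_integration_by_substitutionT (F := fun x => x + m))// ?d1.
- by apply: eq_integral => x _; rewrite !fctE/= mulr1.
- by move=> x y; rewrite ltrD2r.
- by move=> x; exact: cvg_cst.
- exact: is_cvg_cst.
- exact: is_cvg_cst.
- exact: cvg_addrr_Ny.
- exact: cvg_addrr.
Qed.

(** Split at 0 and fold the negative half onto the positive one: [f] and its reflection give the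
    same two terms in opposite order. *)
Lemma ge0_integral_opp (f : R -> R) : continuous f -> (forall x, 0 <= f x) ->
  (\int[mu]_x (f x)%:E = \int[mu]_x (f (- x))%:E)%E.
Proof.
have split0 (g : R -> R) : continuous g -> (forall x, 0 <= g x) ->
    (\int[mu]_x (g x)%:E = \int[mu]_(x in `[0%R, +oo[) (g (- x))%:E +
                           \int[mu]_(x in `[0%R, +oo[) (g x)%:E)%E.
  move=> cg g0; have mg := continuous_measurable_fun cg.
  rewrite -(setUv (`]-oo, 0%R[%classic : set R)) ge0_integral_setU//=; last 4 first.
    exact: measurableC.
    by apply/measurable_EFinP; rewrite setUv.
    by move=> x _; rewrite lee_fin.
    exact/disj_setPCl.
  rewrite setCitvl integral_itv_bndo_bndc; last exact/measurable_EFinP/measurable_funTS.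
  by rewrite -{1}oppr0 ge0_integration_by_substitutionNy// oppr0; exact: continuous_subspaceT.
move=> cf f0.
have cfN : continuous (f \o -%R).
  by move=> x; apply: (@continuous_comp R R R -%R f); [exact: opp_continuous|exact: cf].
rewrite (split0 f)// (split0 (f \o -%R))//; last by move=> x; exact: f0.
by rewrite addeC; congr (_ + _)%E; apply: eq_integral => x _; rewrite /= opprK.
Qed.

End normal_moments.

(** * Mean and variance of a normal random variable *)

Section normal_law.
Context d (T : measurableType d) (R : realType) (P : probability T R).
Variables (Z : {RV P >-> R}) (m s : R).
Hypotheses (s0 : 0 < s) (ZN : has_normal_law Z m s).

(** Push [P] forward to the normal law, pass to its density, and shift by [m]. Since [g] is
    nonnegative, this applies before any moment is known to be finite. *)
Lemma ge0_integral_normal_law (g : R -> R) : continuous g -> (forall x, 0 <= g x) ->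
  (\int[P]_w (g (Z w - m))%:E =
   \int[lebesgue_measure]_x (g x * normal_pdf 0 s x)%:E)%E.
Proof.
move=> cg g0; have sN0 : s != 0 by rewrite gt_eqF.
have cgm : continuous (fun x => g (x - m)).
  move=> x; apply: (@continuous_comp R R R (fun x => x - m) g); last exact: cg.
  by apply: cvgB; [exact: cvg_id|exact: cvg_cst].
have mgm : measurable_fun [set: R] (fun x => (g (x - m))%:E).
  by apply/measurable_EFinP; exact: continuous_measurable_fun.
(* [normal_prob] lives on [measurableTypeR R], whose display differs from that
   of [R]. *)
have mZ : measurable_fun setT (Z : T -> measurableTypeR R)
  by move=> mD A mA; rewrite setTI; exact: (@measurable_funPTI _ _ _ _ Z A mA).
transitivity (\int[pushforward P (Z : T -> measurableTypeR R)]_y (g (y - m))%:E)%E.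
  by rewrite ge0_integral_pushforward// => y _; rewrite lee_fin.
rewrite (eq_measure_integral (normal_prob m s)); last by move=> A mA _; exact: ZN.
rewrite [LHS]ge0_integral_normal_prob//; last by move=> x; rewrite lee_fin.
rewrite (ge0_integral_shift m (f := fun x => g (x - m) * normal_pdf m s x)).
- apply: eq_integral => x _; rewrite addrK; congr ((_ * _)%:E).
  by rewrite !normal_pdfE// /normal_fun addrK subr0.
- by move=> x; apply: cvgM; [exact: cgm|exact: continuous_normal_pdf].
- by move=> x; rewrite mulr_ge0 ?normal_pdf_ge0.
Qed.

Lemma normal_law_variance : (\int[P]_w ((Z w - m) ^+ 2)%:E = (s ^+ 2)%:E)%E.
Proof.
rewrite (ge0_integral_normal_law (g := fun x => x ^+ 2)).
- exact: integral_sqr_normal_pdf.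
- by move=> x; exact: exprn_continuous.
- by move=> x; exact: sqr_ge0.
Qed.

Let mZm : measurable_fun [set: T] (fun w => Z w - m).
Proof. exact: measurable_funB. Qed.

Lemma integrable_normal_law_sqr : P.-integrable setT (fun w => ((Z w - m) ^+ 2)%:E).
Proof.
apply/integrableP; split; first by apply/measurable_EFinP; exact: measurable_funX.
under eq_integral do rewrite gee0_abs ?lee_fin ?sqr_ge0//.
by rewrite normal_law_variance ltry.
Qed.

Lemma integrable_normal_law : P.-integrable setT (fun w => (Z w - m)%:E).
Proof.
apply: (@le_integrable _ _ _ P setT _ _ (fun w => (1 + (Z w - m) ^+ 2)%:E)) => //.
- exact/measurable_EFinP.
- move=> w _ /=; rewrite lee_fin (@ger0_norm _ (1 + _)) ?addr_ge0 ?sqr_ge0//.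
  (* From [(|x| - 1/2)^2 >= 0] follows [|x| <= x^2 + 1/4]. *)
  set x := Z w - m; rewrite -(real_normK (num_real x)).
  have := sqr_ge0 (`|x| - 1 / 2); lra.
- have -> : (fun w => (1 + (Z w - m) ^+ 2)%:E) =
    (cst 1%:E \+ (fun w => ((Z w - m) ^+ 2)%:E))%E by [].
  apply: integrableD => //; first exact: finite_measure_integrable_cst.
  exact: integrable_normal_law_sqr.
Qed.

(** The density is even, so reflection identifies the integrals of the positive and negative parts.
    Integrability makes them finite, so their difference is 0. *)
Lemma normal_law_mean : (\int[P]_w (Z w - m)%:E = 0)%E.
Proof.
have cpos : continuous (fun x : R => Num.max x 0).
  by move=> x; apply: continuous_max; [exact: cvg_id|exact: cvg_cst].
have cneg : continuous (fun x : R => Num.max (- x) 0).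
  move=> x; apply: (@continuous_comp R R R -%R (Num.max ^~ 0)).
    exact: opp_continuous.
  exact: cpos.
have pN x : normal_pdf 0 s x = normal_pdf 0 s (- x).
  by rewrite !normal_pdfE ?gt_eqF// /normal_fun !subr0 sqrrN.
pose f w := (Z w - m)%:E.
have negpos : (\int[P]_w (f^\- w) = \int[P]_w (f^\+ w))%E.
  transitivity (\int[P]_w (Num.max (- (Z w - m)) 0)%:E)%E.
    by apply: eq_integral => w _; rewrite funenegE -EFin_max.
  transitivity (\int[P]_w (Num.max (Z w - m) 0)%:E)%E; last first.
    by apply: eq_integral => w _; rewrite funeposE -EFin_max.
  rewrite (ge0_integral_normal_law (g := fun x => Num.max (- x) 0))//; last first.
    by move=> x; rewrite le_max lexx orbT.
  rewrite (ge0_integral_normal_law (g := fun x => Num.max x 0))//; last first.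
    by move=> x; rewrite le_max lexx orbT.
  rewrite ge0_integral_opp.
  - by apply: eq_integral => x _; rewrite opprK -pN.
  - by move=> x; apply: cvgM; [exact: cneg|apply: continuous_normal_pdf; rewrite gt_eqF].
  - by move=> x; rewrite mulr_ge0 ?normal_pdf_ge0// le_max lexx orbT.
rewrite integralE negpos subee//; apply: integrable_fin_num => //.
by apply: integrable_funepos => //; exact: integrable_normal_law.
Qed.

End normal_law.

(** * Second moments under independence *)

Section independence.
Context d (T : measurableType d) (R : realType) (P : probability T R).

(** Independence makes the joint law the product of the marginals; Tonelli then gives integrability
    and Fubini the factorization. *)
Lemma integralM_independent (X Y : {RV P >-> R}) (f g : R -> R) :
  (forall A B, measurable A -> measurable B ->
    P (X @^-1` A `&` Y @^-1` B) = (P (X @^-1` A) * P (Y @^-1` B))%E) ->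
  measurable_fun setT f -> measurable_fun setT g ->
  P.-integrable setT (EFin \o (f \o X)) -> P.-integrable setT (EFin \o (g \o Y)) ->
  P.-integrable setT (fun w => (f (X w) * g (Y w))%:E) /\
  (\int[P]_w (f (X w) * g (Y w))%:E =
   (\int[P]_w (f (X w))%:E) * \int[P]_w (g (Y w))%:E)%E.
Proof.
move=> XY mf mg iX iY.
pose m1 : probability R R := distribution P X.
pose m2 : probability R R := distribution P Y.
pose U w := (X w, Y w).
have mU : measurable_fun setT U by exact: measurable_fun_pair.
pose h (z : R * R) := (f z.1 * g z.2)%:E.
have mh : measurable_fun setT h.
  apply/measurable_EFinP; apply: measurable_funM.
    by apply: measurableT_comp => //; exact: measurable_fst.
  by apply: measurableT_comp => //; exact: measurable_snd.
(* The hypothesis is equality on rectangles, which determine the product measure. *)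
have prodE A : measurable A -> (m1 \x m2)%E A = pushforward P U A.
  by move=> mA; apply: (@product_measure_unique _ _ _ _ _ m1 m2 (pushforward P U)).
have f1 : (\int[m1]_x `|(f x)%:E| < +oo)%E.
  rewrite ge0_integral_pushforward//; last by apply: measurableT_comp => //; exact/measurable_EFinP.
  by case/integrableP : iX.
have g1 : (\int[m2]_x `|(g x)%:E| < +oo)%E.
  rewrite ge0_integral_pushforward//; last by apply: measurableT_comp => //; exact/measurable_EFinP.
  by case/integrableP : iY.
have mabs (k : R -> R) : measurable_fun setT k -> measurable_fun setT (fun x => `|k x|%:E).
  by move=> mk; apply/measurable_EFinP; exact: measurableT_comp.
have ih : (m1 \x m2)%E.-integrable setT h.
  apply/integrable12ltyP => //.
  have inner x : (\int[m2]_y `|h (x, y)| = `|f x|%:E * \int[m2]_y `|(g y)%:E|)%E.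
    rewrite -ge0_integralZl//; last by exact: mabs.
    by apply: eq_integral => y _; rewrite /h/= normrM EFinM.
  under eq_integral => x _ do rewrite inner.
  rewrite ge0_integralZr//; [|exact: mabs|exact: integral_ge0].
  rewrite lte_mul_pinfty// ?integral_ge0// ge0_fin_numE ?integral_ge0//.
have iUh : P.-integrable setT (h \o U).
  apply/integrableP; split; first exact: measurableT_comp.
  case/integrableP : ih => _.
  rewrite (@eq_measure_integral _ _ _ _ (pushforward P U)); last by move=> A mA _; exact: prodE.
  by rewrite ge0_integral_pushforward//; exact: measurableT_comp.
split; first exact: iUh.
transitivity (\int[pushforward P U]_z h z)%E; first by rewrite integral_pushforward.
transitivity (\int[m1 \x m2]_z h z)%E.
  by apply/esym; apply: eq_measure_integral => A mA _; exact: prodE.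
rewrite -integral12_prod_meas1//.
have iYm : m2.-integrable setT (EFin \o g).
  by apply/integrableP; split => //; exact/measurable_EFinP.
have iXm : m1.-integrable setT (EFin \o f).
  by apply/integrableP; split => //; exact/measurable_EFinP.
rewrite /fubini_F/=.
under eq_integral => x _ do (under eq_integral => y _ do rewrite /h/= EFinM; rewrite integralZl//=).
(* The inner integral must be a real number to be pulled out as a constant. *)
have fg : (\int[m2]_y (g y)%:E)%E \is a fin_num by exact: integrable_fin_num.
rewrite -(fineK fg) integralZr// (fineK fg).
congr (_ * _)%E.
  by rewrite integral_pushforward//; exact/measurable_EFinP.
by rewrite integral_pushforward//; exact/measurable_EFinP.
Qed.

(** The risk is quadratic in the noise, so independence enters only through pairs of entries. *)
Lemma mutually_independent_pair (I : finType) (Z : I -> {RV P >-> R}) (i l : I) :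
  mutually_independent Z -> i != l ->
  forall A B, measurable A -> measurable B ->
  P (Z i @^-1` A `&` Z l @^-1` B) = (P (Z i @^-1` A) * P (Z l @^-1` B))%E.
Proof.
move=> indZ il A B mA mB.
have li : (l == i) = false by rewrite eq_sym (negbTE il).
have /= := indZ [set i; l]%SET (fun k => if k == i then A else B).
rewrite big_setU1 ?inE//= big_set1 eqxx li => <-; last by move=> k _; case: ifP.
congr (P _); apply/seteqP; split => [w [/= Aw Bw] k|w h].
  by rewrite /= !inE => /orP[] /eqP ->; rewrite ?eqxx ?li.
split; first by have := h i; rewrite /= !inE eqxx/=; apply.
by have := h l; rewrite /= !inE eqxx li orbT/=; apply.
Qed.

(** Expand the square: the linear part has mean 0, and uncorrelatedness ([v *+ (i == l)] is [v]
    times the Kronecker delta) leaves only the diagonal of the double sum. *)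
Lemma integral_sqr_affine (n : nat) (Z : 'I_n -> T -> R) (v c : R) (a : 'I_n -> R) :
  (forall i, P.-integrable setT (EFin \o Z i)) ->
  (forall i l, P.-integrable setT (fun w => (Z i w * Z l w)%:E)) ->
  (forall i, \int[P]_w (Z i w)%:E = 0)%E ->
  (forall i l, \int[P]_w (Z i w * Z l w)%:E = (v *+ (i == l))%:E)%E ->
  (\int[P]_w ((\sum_i a i * Z i w + c) ^+ 2)%:E = (v * \sum_i a i ^+ 2 + c ^+ 2)%:E)%E.
Proof.
move=> i1 i2 E1 E2.
pose q w := (\sum_i \sum_l (a i * a l)%:E * (Z i w * Z l w)%:E)%E.
pose r w := (\sum_i (2 * c * a i)%:E * (Z i w)%:E)%E.
have iq1 i : P.-integrable setT (fun w => \sum_l (a i * a l)%:E * (Z i w * Z l w)%:E)%E.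
  by apply: integrable_sum => // l _; exact: integrableZl.
have iq : P.-integrable setT q by exact: integrable_sum.
have ir : P.-integrable setT r.
  by apply: integrable_sum => // l _; exact: (integrableZl _ _ (i1 l)).
have ic : P.-integrable setT (cst (c ^+ 2)%:E) by exact: finite_measure_integrable_cst.
transitivity (\int[P]_w (q w + r w + cst (c ^+ 2)%:E w))%E.
  apply: eq_integral => w _; rewrite /q /r /=.
  under [in RHS]eq_bigr do under eq_bigr do rewrite -EFinM.
  under [X in (_ + X + _)%E]eq_bigr do rewrite -EFinM.
  under [in RHS]eq_bigr do rewrite sumEFin.
  rewrite !sumEFin -!EFinD; congr (_%:E).
  rewrite sqrrD; congr (_ + _ + _).
    rewrite expr2 mulr_suml; apply: eq_bigr => i _; rewrite mulr_sumr.
    by apply: eq_bigr => l _; rewrite mulrACA.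
  by rewrite -mulr_natl mulrA mulr_sumr mulr_suml; apply: eq_bigr => i _; ring.
rewrite integralD//; last exact: integrableD.
rewrite integralD// integral_cst//= probability_setT mule1.
have -> : (\int[P]_w r w = 0)%E.
  rewrite integral_sum//; last by move=> i; exact: (integrableZl _ _ (i1 i)).
  by rewrite big1// => i _; rewrite integralZl ?E1 ?mule0//; exact: i1.
have -> : (\int[P]_w q w = \sum_i ((a i * a i * v)%:E))%E.
  rewrite integral_sum//; apply: eq_bigr => i _.
  rewrite integral_sum//; last by move=> l; exact: integrableZl.
  under eq_bigr => l _ do rewrite integralZl// E2 -EFinM.
  rewrite sumEFin (bigD1 i)//= eqxx big1 ?addr0 ?mulr1n//.
  by move=> l; rewrite eq_sym => /negbTE ->; rewrite mulr0n mulr0.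
rewrite adde0 sumEFin -EFinD; congr (_%:E); congr (_ + _).
by rewrite mulr_sumr; apply: eq_bigr => i _; rewrite mulrC expr2.
Qed.

End independence.

(** * The Frobenius inner product *)

Section frobenius.
Context {R : realType}.

(** The trace form lets cross terms be computed by matrix algebra rather than entrywise. *)
Definition frobenius_dot {m n : nat} (A B : 'M[R]_(m, n)) : R := \tr (A *m B^T).

Lemma frobenius_dotE {m n : nat} (A : 'M[R]_(m, n)) :
  frobenius_dot A A = \sum_i \sum_j A i j ^+ 2.
Proof.
by apply: eq_bigr => i _; rewrite mxE; apply: eq_bigr => j _; rewrite mxE expr2.
Qed.

Lemma frobenius_dot_ge0 {m n : nat} (A : 'M[R]_(m, n)) : 0 <= frobenius_dot A A.
Proof.
by rewrite frobenius_dotE; apply: sumr_ge0 => i _; apply: sumr_ge0 => j _; exact: sqr_ge0.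
Qed.

Lemma frobenius_dot_eq0 {m n : nat} (A : 'M[R]_(m, n)) : frobenius_dot A A = 0 -> A = 0.
Proof.
have row0 i : 0 <= \sum_j A i j ^+ 2 by apply: sumr_ge0 => j _; exact: sqr_ge0.
rewrite frobenius_dotE => /eqP; rewrite psumr_eq0// => /allP A0.
apply/matrixP => i j; rewrite mxE; apply/eqP.
move: (A0 i); rewrite mem_index_enum => /(_ isT); rewrite psumr_eq0 => [/allP/(_ j)|k _].
  by rewrite mem_index_enum sqrf_eq0; apply.
exact: sqr_ge0.
Qed.

Lemma frobenius_dot_sqrD {m n : nat} (A B : 'M[R]_(m, n)) :
  frobenius_dot (A + B) (A + B) =
  frobenius_dot A A + frobenius_dot B B + 2 * frobenius_dot A B.
Proof.
have BA : \tr (B *m A^T) = \tr (A *m B^T) by rewrite -mxtrace_tr trmx_mul trmxK.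
rewrite /frobenius_dot linearD/= mulmxDl !mulmxDr !linearD/= BA; ring.
Qed.

Lemma frobenius_norm_sqr {m n : nat} (A : 'M[R]_(m, n)) :
  frobenius_norm A ^+ 2 = frobenius_dot A A.
Proof. by rewrite /frobenius_norm -frobenius_dotE sqr_sqrtr// frobenius_dot_ge0. Qed.

End frobenius.

(** * Minimization of the deterministic quadratic risk *)

Section affine_denoiser.
Variables (R : realType) (n k : nat) (X : 'M[R]_(n, k)) (sigma : R).
Hypotheses (hk : (0 < k)%N) (hsigma : 0 < sigma).

Let kN0 : k%:R != 0 :> R. Proof. by rewrite pnatr_eq0 -lt0n. Qed.

Let Xc := X - col_mean X *m (ones R k)^T.

Lemma ones_dot : (ones R k)^T *m ones R k = k%:R%:M.
Proof.
apply/matrixP => i j; rewrite !mxE !ord1 eqxx mulr1n.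
by under eq_bigr do rewrite !mxE mulr1; rewrite sumr_const card_ord.
Qed.

Lemma centered_ones : Xc *m ones R k = 0.
Proof.
rewrite mulmxBl -mulmxA ones_dot mul_mx_scalar /col_mean scalerA divff// scale1r subrr//.
Qed.

(** Replacing [X^T] by [Xc^T] drops only [Xc 1 mu^T], which is 0. *)
Lemma centered_tr : Xc *m X^T = k%:R *: col_cov X.
Proof.
rewrite /col_cov scalerA divff// scale1r -/Xc.
have -> : X^T = Xc^T + ones R k *m (col_mean X)^T.
  by rewrite /Xc linearB/= trmx_mul trmxK subrK.
by rewrite mulmxDr mulmxA centered_ones mul0mx addr0.
Qed.

(** If [u (C + sigma^2 I) = 0], multiplying by [u^T] gives [|u Xc|^2 / k + sigma^2 |u|^2 = 0], so
    [u = 0]. *)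
Lemma col_cov_unitmx : col_cov X + (sigma ^+ 2)%:M \in unitmx.
Proof.
rewrite -row_free_unit -kermx_eq0; apply/rowV0P => u /sub_kermxP uC.
have s2 : 0 < sigma ^+ 2 by rewrite exprn_gt0.
have k0 : 0 < k%:R^-1 :> R by rewrite invr_gt0 ltr0n.
have : k%:R^-1 * frobenius_dot (u *m Xc) (u *m Xc) + sigma ^+ 2 * frobenius_dot u u = 0.
  have := congr1 (fun v => \tr (v *m u^T)) uC; rewrite /frobenius_dot /= mul0mx linear0 => <-.
  rewrite [in RHS]mulmxDr [in RHS]mulmxDl [RHS]linearD/= mul_mx_scalar -scalemxAl.
  congr (_ + _); last by rewrite linearZ.
  by rewrite /col_cov -/Xc -scalemxAr -scalemxAl linearZ/= trmx_mul !mulmxA.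
move=> /eqP; rewrite paddr_eq0 ?mulr_ge0 ?frobenius_dot_ge0 ?ltW// => /andP[_].
by rewrite mulf_eq0 gt_eqF//= => /eqP/frobenius_dot_eq0.
Qed.

Definition quadratic_risk (Theta : 'M[R]_n) (beta : 'cV[R]_n) : R :=
  let E := Theta *m X + beta *m (ones R k)^T - X in
  frobenius_dot E E + k%:R * sigma ^+ 2 * frobenius_dot Theta Theta.

(* The first-order condition [Theta_hat (C + sigma^2 I) = C] kills the cross term. *)
Lemma quadratic_riskD (D : 'M[R]_n) (b : 'cV[R]_n) :
  let E := D *m X + b *m (ones R k)^T in
  quadratic_risk (Theta_hat X sigma + D) (beta_hat X sigma + b) =
  quadratic_risk (Theta_hat X sigma) (beta_hat X sigma) +
  (frobenius_dot E E + k%:R * sigma ^+ 2 * frobenius_dot D D).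
Proof.
move=> E; set Th := Theta_hat X sigma; set be := beta_hat X sigma.
set F := Th *m X + be *m (ones R k)^T - X.
have FE : F = (Th - 1%:M) *m Xc.
  rewrite /F /be /beta_hat -/Th /Xc [RHS]mulmxBr mulmxA -[1%:M - Th]opprB !mulNmx.
  by rewrite (mulmxBl Th 1%:M X) mul1mx addrAC.
have hTh : Th *m col_cov X + sigma ^+ 2 *: Th = col_cov X.
  by rewrite -mul_mx_scalar -mulmxDr /Th /Theta_hat mulmxKV// col_cov_unitmx.
(* The [b] part of [E] is paired with [F 1 = 0]; the [D] part is paired with
   [F X^T = k (Th C - C) = - k sigma^2 Th], cancelling the second term. *)
have cross : frobenius_dot F E + k%:R * sigma ^+ 2 * frobenius_dot Th D = 0.
  have FX : F *m X^T = k%:R *: (Th *m col_cov X - col_cov X).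
    by rewrite FE -mulmxA centered_tr -scalemxAr mulmxBl mul1mx.
  have F1 : F *m ones R k = 0 by rewrite FE -mulmxA centered_ones mulmx0.
  rewrite /frobenius_dot /E linearD/= !trmx_mul trmxK mulmxDr !mulmxA F1 mul0mx addr0 FX.
  rewrite -mulrA -scalemxAl linearZ/= -mulrDr -linearZ/= scalemxAl -linearD/= -mulmxDl.
  by rewrite addrAC hTh subrr mul0mx linear0 mulr0.
rewrite /quadratic_risk -/F.
have -> : (Th + D) *m X + (be + b) *m (ones R k)^T - X = F + E.
  rewrite /F /E !mulmxDl -!addrA; congr (_ + _); rewrite addrCA; congr (_ + _).
  by rewrite addrA addrC.
rewrite !frobenius_dot_sqrD; move: cross; lra.
Qed.

(** The [iff] form carries minimality and uniqueness together. Equality forces [D = 0] because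
    [k sigma^2 > 0]; then [b 1^T = 0], and multiplying by [1] gives [k b = 0]. *)
Lemma quadratic_risk_min (Theta : 'M[R]_n) (beta : 'cV[R]_n) :
  quadratic_risk (Theta_hat X sigma) (beta_hat X sigma) <= quadratic_risk Theta beta
  ?= iff ((Theta, beta) == (Theta_hat X sigma, beta_hat X sigma)).
Proof.
have := quadratic_riskD (Theta - Theta_hat X sigma) (beta - beta_hat X sigma).
rewrite !(addrC _ (_ - _)) !subrK => /= ->.
set D := Theta - _; set b := beta - _; set E := D *m X + _.
have ks : 0 < k%:R * sigma ^+ 2 by rewrite mulr_gt0 ?exprn_gt0 ?ltr0n.
have P0 : 0 <= frobenius_dot E E + k%:R * sigma ^+ 2 * frobenius_dot D D.
  by rewrite addr_ge0 ?mulr_ge0 ?frobenius_dot_ge0// ltW.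
split; first by rewrite lerDl.
rewrite -[X in X == _]addr0 (inj_eq (addrI _)); apply/eqP/eqP => [|[TE bE]].
  have kD := mulr_ge0 (ltW ks) (frobenius_dot_ge0 D).
  move=> /esym/eqP; rewrite paddr_eq0 ?frobenius_dot_ge0//.
  rewrite mulf_eq0 (gt_eqF ks)/= => /andP[/eqP/frobenius_dot_eq0 E0 /eqP/frobenius_dot_eq0 D0].
  move: E0; rewrite /E D0 mul0mx add0r => b1.
  have b0 : b = 0.
    have := congr1 (mulmx^~ (ones R k)) b1; rewrite /= -mulmxA ones_dot mul_mx_scalar mul0mx.
    by move/eqP; rewrite scaler_eq0 (negbTE kN0) => /eqP.
  by congr (_, _); apply/eqP; rewrite -subr_eq0; apply/eqP.
by rewrite /E /D /b TE bE !subrr !mul0mx addr0 /frobenius_dot !mul0mx linear0 mulr0 addr0.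
Qed.

End affine_denoiser.

(** * From the expected loss to the quadratic risk, and the theorem *)

Lemma riskE d (T : measurableType d) (R : realType) (P : probability T R) (n k : nat)
    (sigma : R) (X : 'M[R]_(n, k)) (Y : 'I_n -> 'I_k -> {RV P >-> R})
    (Theta : 'M[R]_n) (beta : 'cV[R]_n) :
  0 < sigma ->
  (forall i j, has_normal_law (Y i j) (X i j) sigma) ->
  (forall j, mutually_independent (fun i => Y i j)) ->
  risk X Y Theta beta = (quadratic_risk X sigma Theta beta)%:E.
Proof.
move=> s0 YN Yind.
(* The column index comes first, so that [W j] is the independent family of one column. *)
pose W j i w := Y i j w - X i j.
pose c i j := (Theta *m X + beta *m (ones R k)^T - X) i j.
pose q i j w := ((\sum_l Theta i l * W j l w + c i j) ^+ 2)%:E.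
have Wmean j i : (\int[P]_w (W j i w)%:E = 0)%E by exact: normal_law_mean (YN i j).
have Wint j i : P.-integrable setT (EFin \o W j i).
  exact: integrable_normal_law (YN i j).
have WW j i l : P.-integrable setT (fun w => (W j i w * W j l w)%:E) /\
    (\int[P]_w (W j i w * W j l w)%:E = (sigma ^+ 2 *+ (i == l))%:E)%E.
  have [<-|il] := eqVneq i l.
    split; first exact: integrable_normal_law_sqr (YN i j).
    by rewrite mulr1n; exact: normal_law_variance (YN i j).
  have mB m : measurable_fun [set: R] (fun x : R => x - m) by exact: measurable_funB.
  have [? ->] := integralM_independent (mutually_independent_pair (Yind j) il)
    (mB _) (mB _) (Wint j i) (Wint j l).
  by split => //; rewrite (Wmean j i) mul0e.
have qE i j : (\int[P]_w q i j w = (sigma ^+ 2 * \sum_l Theta i l ^+ 2 + c i j ^+ 2)%:E)%E.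
  by apply: integral_sqr_affine => // l l'; have [] := WW j l l'.
have mq i j : measurable_fun setT (q i j).
  apply/measurable_EFinP; apply: measurable_funX; apply: measurable_funD => //.
  apply: measurable_sum => l; apply: measurable_funM => //.
  exact: measurable_funB.
rewrite /risk unlock.
(* Entry [(i, j)] of the residual involves noise from column [j] only. Columns are merely summed, so
   no joint law across columns enters. *)
transitivity (\int[P]_w (\sum_i \sum_j q i j w))%E.
  apply: eq_integral => w _; rewrite frobenius_norm_sqr frobenius_dotE -sumEFin.
  apply: eq_bigr => i _; rewrite -sumEFin; apply: eq_bigr => j _.
  rewrite /q /c; congr ((_ ^+ 2)%:E).
  rewrite !mxE /W; under [in RHS]eq_bigr do rewrite mulrBr.
  rewrite sumrB; under eq_bigr do rewrite mxE; ring.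
rewrite ge0_integral_sum//; last 2 first.
- by move=> i; apply: emeasurable_sum.
- by move=> i w _; apply: sume_ge0 => j _; rewrite lee_fin sqr_ge0.
(* The noise term does not depend on [j]; summing it over the columns produces the factor [k]. *)
under eq_bigr => i _.
  rewrite ge0_integral_sum//; last by move=> j w _; rewrite lee_fin sqr_ge0.
  under eq_bigr do rewrite qE.
  rewrite sumEFin big_split/= sumr_const card_ord.
  over.
rewrite sumEFin big_split/= /quadratic_risk !frobenius_dotE; congr (_%:E).
rewrite [LHS]addrC; congr (_ + _).
by rewrite sumrMnl -mulr_sumr -mulrA mulr_natl.
Qed.

Theorem proposition7 (d : measure_display) (T : measurableType d)
    (R : realType) (P : probability T R) (n k : nat)
    (hn : (0 < n)%N) (hk : (0 < k)%N)
    (sigma : R) (hsigma : 0 < sigma)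
    (X : 'M[R]_(n, k)) (Y : 'I_n -> 'I_k -> {RV P >-> R})
    (hlaw : forall i j, has_normal_law (Y i j) (X i j) sigma)
    (hindep : forall j, mutually_independent (fun i => Y i j)) :
  col_cov X + (sigma ^+ 2)%:M \in unitmx /\
  argmin (fun p : 'M[R]_n * 'cV[R]_n => risk X Y p.1 p.2) =
    [set (Theta_hat X sigma, beta_hat X sigma)].
Proof.
(* [invmx] returns its argument on a singular matrix, so this conjunct certifies that [Theta_hat]
   contains a true inverse. *)
split; first exact: col_cov_unitmx.
have rE Theta beta := riskE Theta beta hsigma hlaw hindep.
have qmin := quadratic_risk_min X hk hsigma.
apply/seteqP; split => [|_ ->] [A b] /=.
  (* Testing a minimizer against the candidate gives the reverse inequality, hence the equality case
     of [quadratic_risk_min]. *)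
  move=> /(_ (Theta_hat X sigma, beta_hat X sigma)); rewrite /= !rE lee_fin.
  by rewrite (ge_leif (qmin _ _)) => /eqP.
by rewrite !rE lee_fin; exact: (qmin _ _).1.
Qed.
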